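(* Given a positive construction sequence of length $m$ for a graph $G$, one can compute in time $O(m)$ a distance model for $G$ with $0$–$1$ edge weights of size $O(m)$.
   Context: A construction sequence of $G$ with vertex set $V$ is a sequence $(\mathcal P_1,E_1,N_1),\dots,(\mathcal P_m,E_m,N_m)$ of partitions $\mathcal P_i$ of $V$ and $E_i,N_i\subseteq\binom V2$, starting with singletons and $E_1=N_1=\emptyset$, each step being a merge (replace two parts $A,B$ by $A\cup B$), a positive resolve (for parts $A,B$, possibly equal, $E_{i+1}=E_i\cup(AB\setminus N_i)$, $AB$ being the pairs between $A$ and $B$) or a negative resolve ($N_{i+1}=N_i\cup(AB\setminus E_i)$); it constructs $(V,E_m)$, which is $G$. It is positive if it contains only positive resolves. A distance model for $G$ is a weighted directed graph $H$ with $V(G)\subseteq V(H)$ such that $\mathrm{dist}_H(x,y)=\mathrm{dist}_G(x,y)$ for all $x,y\in V(G)$; its size is its number of vertices plus edges.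
   Formalization: The time and size bounds are proved as O(m + number of isolated vertices of G) instead of O(m), since a sequence of length 1 constructs the edgeless graph on any n vertices, whose distance models all have at least n vertices. *)

(* Defs.v *)
From mathcomp Require Import all_boot.
From mathcomp Require Import boolp.

Set Implicit Arguments.
Unset Strict Implicit.
Unset Printing Implicit Defensive.

(** * Distances *)

(* The least element of a set of walk lengths; [None] is the infinite distance,
   i.e. there is no walk. *)
Definition least_length (L : nat -> Prop) : option nat :=
  match pselect (exists k, `[< L k >]) with
  | left ex => Some (ex_minn ex)
  | right _ => None
  end.

(** * Graphs *)

Definition pairs (V : finType) : {set {set V}} := [set e : {set V} | #|e| == 2].

Record graph (V : finType) := Graph {
  edges : {set {set V}};
  edges_pairs : edges \subset pairs V
}.

Section Graph.
Variables (V : finType) (G : graph V).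

Definition adj : rel V := fun x y => [set x; y] \in edges G.

Definition isolated : {set V} := [set x | [forall y, ~~ adj x y]].

Definition dist (x y : V) : option nat :=
  least_length
    (fun k => exists p : seq V, [/\ path adj x p, last x p = y & size p = k]).

End Graph.

(** * Weighted directed graphs and distance models *)

(* [weight x y] is only meaningful when [arc x y] holds. *)
Record wdigraph (W : finType) := WDigraph {
  arc : rel W;
  weight : W -> W -> nat
}.

Section WDigraph.
Variables (W : finType) (H : wdigraph W).

Fixpoint walk_weight (x : W) (p : seq W) : nat :=
  if p is y :: q then weight H x y + walk_weight y q else 0.

Definition wdist (x y : W) : option nat :=
  least_length
    (fun k => exists p : seq W,
       [/\ path (arc H) x p, last x p = y & walk_weight x p = k]).

Definition wsize : nat := #|W| + #|[set a : W * W | arc H a.1 a.2]|.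

Definition weights01 : Prop := forall x y, arc H x y -> weight H x y \in [:: 0; 1].

End WDigraph.

(* The inclusion of V(G) in V(H) is an injection [f]. *)
Definition distance_model (V W : finType) (G : graph V) (H : wdigraph W)
    (f : V -> W) : Prop :=
  injective f /\ forall x y, wdist H (f x) (f y) = dist G x y.

(** * Construction sequences *)

Section Construction.
Variable V : finType.

Record cstate := CState {
  parts : {set {set V}};
  Eset : {set {set V}};
  Nset : {set {set V}}
}.

Inductive cop :=
  | Merge of {set V} & {set V}
  | PosResolve of {set V} & {set V}
  | NegResolve of {set V} & {set V}.

Definition between (A B : {set V}) : {set {set V}} :=
  [set [set x; y] | x in A, y in B & x != y].

Definition init_cstate : cstate := CState [set [set x] | x : V] set0 set0.

Definition cstep (o : cop) (s s' : cstate) : Prop :=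
  match o with
  | Merge A B =>
      [/\ A \in parts s, B \in parts s, A != B &
          s' = CState ((A :|: B) |: (parts s :\ A :\ B)) (Eset s) (Nset s)]
  | PosResolve A B =>
      [/\ A \in parts s, B \in parts s &
          s' = CState (parts s) (Eset s :|: (between A B :\: Nset s)) (Nset s)]
  | NegResolve A B =>
      [/\ A \in parts s, B \in parts s &
          s' = CState (parts s) (Eset s) (Nset s :|: (between A B :\: Eset s))]
  end.

(* [sts] lists the triples (P_1,E_1,N_1), ..., (P_m,E_m,N_m); [ops] lists the
   m - 1 steps between consecutive triples. *)
Definition construction_sequence (G : graph V) (sts : seq cstate)
    (ops : seq cop) : Prop :=
  [/\ size sts = (size ops).+1,
      nth init_cstate sts 0 = init_cstate,
      (forall i o, onth ops i = Some o ->
         cstep o (nth init_cstate sts i) (nth init_cstate sts i.+1)) &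
      Eset (last init_cstate sts) = edges G].

Definition positive (ops : seq cop) : bool :=
  all (fun o => if o is NegResolve _ _ then false else true) ops.

(* A step is encoded by an opcode and the names of the two parts it acts on.
   Parts are named 0, 1, 2, ... in order of creation: first the singletons, in
   the order of [enum V], then one new name per merge. [created] lists the parts
   created so far, so the name of A is its index in [created]. *)
Fixpoint encode_ops (created : seq {set V}) (ops : seq cop) : seq nat :=
  match ops with
  | [::] => [::]
  | Merge A B :: ops' =>
      [:: 0; index A created; index B created]
        ++ encode_ops (rcons created (A :|: B)) ops'
  | PosResolve A B :: ops' =>
      [:: 1; index A created; index B created] ++ encode_ops created ops'
  | NegResolve A B :: ops' =>
      [:: 2; index A created; index B created] ++ encode_ops created ops'
  end.

Definition encode_sequence (ops : seq cop) : seq nat :=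
  [:: #|V|; size ops] ++ encode_ops [seq [set x] | x <- enum V] ops.

End Construction.

(* [out] lists every arc once, as source, target, weight, and ends with the
   number of vertices. *)
Definition encodes_wdigraph (h : nat) (H : wdigraph 'I_h) (out : seq nat) : Prop :=
  exists es : seq ('I_h * 'I_h),
    [/\ uniq es,
        (forall x y, ((x, y) \in es) = arc H x y) &
        out = rcons (flatten [seq [:: nat_of_ord a.1; nat_of_ord a.2;
                                      weight H a.1 a.2] | a <- es]) h].

(** * Random access machines *)

(* A RAM with input and output tapes, charged one time unit per instruction.
   The only arithmetic is successor and predecessor, so that t steps cannot
   produce numbers exceeding the constants of the program and the input by more
   than t: the uniform cost measure does not hide long-number arithmetic. *)
Inductive instr :=
  | Const of nat & nat   (* X_i := c *)
  | Copy of nat & nat    (* X_i := X_j *)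
  | Succ of nat          (* X_i := X_i + 1 *)
  | Pred of nat          (* X_i := X_i - 1, truncated at 0 *)
  | Fetch of nat & nat   (* X_i := X_(X_j) *)
  | Put of nat & nat     (* X_(X_i) := X_j *)
  | Jump of nat          (* go to l *)
  | JumpZ of nat & nat   (* if X_i = 0, go to l *)
  | Read of nat          (* X_i := next input symbol, or 0 at the end *)
  | Write of nat.        (* output X_i *)

Definition program := seq instr.

Record config := Config {
  pc : nat;
  mem : nat -> nat;
  inp : seq nat;
  outp : seq nat
}.

Definition set_mem (c : config) (a v : nat) : config :=
  Config (pc c).+1 [eta mem c with a |-> v] (inp c) (outp c).

Definition exec (i : instr) (c : config) : config :=
  match i with
  | Const a k => set_mem c a k
  | Copy a b => set_mem c a (mem c b)
  | Succ a => set_mem c a (mem c a).+1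
  | Pred a => set_mem c a (mem c a).-1
  | Fetch a b => set_mem c a (mem c (mem c b))
  | Put a b => set_mem c (mem c a) (mem c b)
  | Jump l => Config l (mem c) (inp c) (outp c)
  | JumpZ a l =>
      Config (if mem c a == 0 then l else (pc c).+1) (mem c) (inp c) (outp c)
  | Read a =>
      Config (pc c).+1 [eta mem c with a |-> head 0 (inp c)]
        (behead (inp c)) (outp c)
  | Write a => Config (pc c).+1 (mem c) (inp c) (rcons (outp c) (mem c a))
  end.

(* A configuration whose program counter is outside the program is halted. *)
Definition ram_step (p : program) (c : config) : config :=
  if onth p (pc c) is Some i then exec i c else c.

Definition ram_init (x : seq nat) : config := Config 0 (fun=> 0) x [::].

Definition computes_within (p : program) (x : seq nat) (t : nat) (y : seq nat)
    : Prop :=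
  let c := iter t (ram_step p) (ram_init x) in
  size p <= pc c /\ outp c = y.

(* Main.v *)
Require Import Defs.
From mathcomp Require Import all_boot.
From mathcomp Require Import boolp zify.

Set Implicit Arguments.
Unset Strict Implicit.
Unset Printing Implicit Defensive.

(** Every part A that ever occurs gets two nodes, an upper and a lower one. Arcs
    of weight 0 lead from x up to the upper node of A and from the lower node of
    A down to x exactly when x is in A; a merge only connects the nodes of A and
    B with those of their union. A positive resolve of A and B adds arcs from the
    upper node of A to the lower node of B and conversely, of total weight 1; as
    nothing is ever excluded, these are precisely the edges of G. Each of these
    connections passes through a fresh node, so that no arc is ever produced
    twice, even if a resolve is repeated or A = B. Every vertex whose singleton is
    not an operand of a step is isolated, which bounds the number of vertices. *)

(** * Machine runs on memories given by lists *)

(* Configurations whose memory is given by a finite list, so that a straight-line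
   run of the machine can be evaluated. *)
Record lconfig := LConfig {
  lpc : nat;
  lmem : seq nat;
  linp : seq nat;
  loutp : seq nat
}.

Definition config_of (c : lconfig) : config :=
  Config (lpc c) (nth 0 (lmem c)) (linp c) (loutp c).

Definition lset (c : lconfig) (a v : nat) : lconfig :=
  LConfig (lpc c).+1 (set_nth 0 (lmem c) a v) (linp c) (loutp c).

Definition lexec (i : instr) (c : lconfig) : lconfig :=
  let m := nth 0 (lmem c) in
  match i with
  | Const a k => lset c a k
  | Copy a b => lset c a (m b)
  | Succ a => lset c a (m a).+1
  | Pred a => lset c a (m a).-1
  | Fetch a b => lset c a (m (m b))
  | Put a b => lset c (m a) (m b)
  | Jump l => LConfig l (lmem c) (linp c) (loutp c)
  | JumpZ a l =>
      LConfig (if m a == 0 then l else (lpc c).+1) (lmem c) (linp c) (loutp c)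
  | Read a =>
      LConfig (lpc c).+1 (set_nth 0 (lmem c) a (head 0 (linp c)))
        (behead (linp c)) (loutp c)
  | Write a => LConfig (lpc c).+1 (lmem c) (linp c) (rcons (loutp c) (m a))
  end.

Definition lstep (p : program) (c : lconfig) : lconfig :=
  if onth p (lpc c) is Some i then lexec i c else c.

(** The two memories agree beyond the end of the list too: [set_nth] pads with the same default 0
    that [nth] returns there. *)
Lemma ram_step_config_of p c :
  ram_step p (config_of c) = config_of (lstep p c).
Proof.
rewrite /ram_step /lstep /=; case: (onth _ _) => // i.
by case: i => * //=; rewrite /set_mem /config_of /=; congr Config;
   apply/funext => z; rewrite nth_set_nth.
Qed.

Lemma iter_ram_step_config_of p t c :
  iter t (ram_step p) (config_of c) = config_of (iter t (lstep p) c).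
Proof. by elim: t => //= t ->; rewrite ram_step_config_of. Qed.

Lemma iter_lstep_halted p t c :
  size p <= lpc c -> iter t (lstep p) c = c.
Proof.
move=> hp; elim: t => //= t ->; rewrite /lstep.
by rewrite onth_default.
Qed.

(** * The program and the arcs it outputs *)

(* X0: vertices left; X1: next free table cell; X2: next free node; X3: current
   vertex; X4: steps left; X5, X6: nodes of the two parts; X7 = 0; X8 = 1;
   X9: opcode. The cell X_(10 + i) holds the upper node of the part named i.
   The numbers in the program are addresses of jump targets. *)
Definition model_program : program :=
  [:: Read 0; Copy 2 0; Read 4; Const 1 10; Const 8 1;
   (* 5 *)
   JumpZ 0 19; Put 1 2; Succ 1; Write 3; Write 2; Write 7; Succ 2;
   Write 2; Write 3; Write 7; Succ 2; Succ 3; Pred 0; Jump 5]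
  ++
  (* 19 *)
  [:: JumpZ 4 83; Pred 4; Read 9]
  ++ Read 5 :: nseq 10 (Succ 5) ++ Fetch 5 5
  :: Read 6 :: nseq 10 (Succ 6) ++ Fetch 6 6
  :: JumpZ 9 64
  :: [:: Write 5; Write 2; Write 8;
         Succ 6; Write 2; Write 6; Write 7; Pred 6;
         Succ 2; Write 6; Write 2; Write 8;
         Succ 5; Write 2; Write 5; Write 7]
  ++ [:: Jump 81;
  (* 64 *)
         Put 1 2; Succ 1;
         Write 5; Write 2; Write 7; Write 6; Write 2; Write 7;
         Succ 2; Succ 5; Succ 6;
         Write 2; Write 5; Write 7; Write 2; Write 6; Write 7]
  (* 81 *)
  ++ [:: Succ 2; Jump 19;
  (* 83 *)
         Write 2].

Definition flat_arcs (es : seq (nat * nat * nat)) : seq nat :=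
  flatten [seq [:: a.1.1; a.1.2; a.2] | a <- es].

Lemma flat_arcs_cat es es' : flat_arcs (es ++ es') = flat_arcs es ++ flat_arcs es'.
Proof. by rewrite /flat_arcs map_cat flatten_cat. Qed.

(** [x] is the node of the vertex itself. Here and in the next two definitions [a], [b], [v] are
    upper nodes and their successors the lower ones, except that [v] and [v.+1] are the intermediate
    nodes in [resolve_arcs]. Arcs are listed in the order of output. *)
Definition vertex_arcs (x v : nat) := [:: (x, v, 0); (v.+1, x, 0)].

Definition merge_arcs (a b v : nat) :=
  [:: (a, v, 0); (b, v, 0); (v.+1, a.+1, 0); (v.+1, b.+1, 0)].

Definition resolve_arcs (a b v : nat) :=
  [:: (a, v, 1); (v, b.+1, 0); (b, v.+1, 1); (v.+1, a.+1, 0)].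

Fixpoint base_arcs (x v n : nat) : seq (nat * nat * nat) :=
  if n is n'.+1 then vertex_arcs x v ++ base_arcs x.+1 v.+2 n' else [::].

Fixpoint base_table (v n : nat) : seq nat :=
  if n is n'.+1 then v :: base_table v.+2 n' else [::].

Section Compile.
Variable V : finType.
Implicit Types (created : seq {set V}) (tbl : seq nat) (ops : seq (cop V)).

Definition upper_node created tbl (A : {set V}) : nat :=
  nth 0 tbl (index A created).

(** [tbl] runs parallel to [created]. Merges and resolves both use up two node numbers, so [v]
    advances by 2 in either case. *)
Fixpoint step_arcs created tbl (v : nat) ops : seq (nat * nat * nat) :=
  match ops with
  | [::] => [::]
  | Merge A B :: ops' =>
      merge_arcs (upper_node created tbl A) (upper_node created tbl B) v
        ++ step_arcs (rcons created (A :|: B)) (rcons tbl v) v.+2 ops'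
  | PosResolve A B :: ops' =>
      resolve_arcs (upper_node created tbl A) (upper_node created tbl B) v
        ++ step_arcs created tbl v.+2 ops'
  | NegResolve _ _ :: _ => [::]
  end.

End Compile.

(** * Symbolic execution of the program *)

Definition memory (r0 r1 r2 r3 r4 r5 r6 r9 : nat) (tbl : seq nat) : seq nat :=
  [:: r0, r1, r2, r3, r4, r5, r6, 0, 1, r9 & tbl].

Notation run t c := (iter t (lstep model_program) c).

Lemma set_nth_size (s : seq nat) v : set_nth 0 s (size s) v = rcons s v.
Proof. by elim: s => //= x s ->. Qed.

Lemma run_vertex n x v r4 r5 r6 r9 tbl i o :
  run 14 (LConfig 5 (memory n.+1 (10 + size tbl) v x r4 r5 r6 r9 tbl) i o) =
  LConfig 5 (memory n (11 + size tbl) v.+2 x.+1 r4 r5 r6 r9 (rcons tbl v)) i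
    (o ++ flat_arcs (vertex_arcs x v)).
Proof.
(* The new table cell becomes a [set_nth] at the end and the output an iterated [rcons], as the
   machine produces them; both sides then have the same normal form. *)
rewrite /flat_arcs /= -set_nth_size -!cat_rcons cats0.
vm_compute.
by [].
Qed.

Lemma run_vertices n x v r4 r5 r6 r9 tbl i o :
  run (14 * n) (LConfig 5 (memory n (10 + size tbl) v x r4 r5 r6 r9 tbl) i o) =
  LConfig 5 (memory 0 (10 + (size tbl + n)) (v + n.*2) (x + n) r4 r5 r6 r9
               (tbl ++ base_table v n)) i
    (o ++ flat_arcs (base_arcs x v n)).
Proof.
elim: n x v tbl o => [|n IH] x v tbl o; first by rewrite muln0 /= !addn0 !cats0.
rewrite mulnS addnC iterD run_vertex [11 + _]addSn -addnS -(size_rcons tbl v) IH.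
rewrite size_rcons cat_rcons -catA -flat_arcs_cat.
by congr (LConfig _ (memory _ _ _ _ _ _ _ _ _) _ _); lia.
Qed.

(** 47 = 3 + 24 + 1 + 17 + 2: loop head, fetching both operands, branching, the branch, loop end.
    The resolve branch, with its closing jump, also has 17 instructions, so every step costs the
    same. *)
Lemma run_merge k m v x r5 r6 r9 tbl a b i o : k = size tbl ->
  run 47 (LConfig 19 (memory 0 (10 + k) v x m.+1 r5 r6 r9 tbl)
            [:: 0, a, b & i] o) =
  LConfig 19 (memory 0 (10 + k.+1) v.+2 x m (nth 0 tbl a).+1 (nth 0 tbl b).+1 0
                (rcons tbl v)) i
    (o ++ flat_arcs (merge_arcs (nth 0 tbl a) (nth 0 tbl b) v)).
Proof.
move=> kE; rewrite /flat_arcs /= -set_nth_size -!cat_rcons cats0 -kE.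
by vm_compute.
Qed.

Lemma run_resolve k m v x r5 r6 r9 tbl a b i o :
  run 47 (LConfig 19 (memory 0 (10 + k) v x m.+1 r5 r6 r9 tbl)
            [:: 1, a, b & i] o) =
  LConfig 19 (memory 0 (10 + k) v.+2 x m (nth 0 tbl a).+1 (nth 0 tbl b) 1 tbl) i
    (o ++ flat_arcs (resolve_arcs (nth 0 tbl a) (nth 0 tbl b) v)).
Proof.
rewrite /flat_arcs /= -!cat_rcons cats0.
by vm_compute.
Qed.

Lemma run_steps (V : finType) (ops : seq (cop V)) created tbl v x r5 r6 r9 o :
  positive ops ->
  exists k s5 s6 s9 tbl',
  run (47 * size ops)
    (LConfig 19 (memory 0 (10 + size tbl) v x (size ops) r5 r6 r9 tbl)
       (encode_ops created ops) o) =
  LConfig 19 (memory 0 k (v + (size ops).*2) x 0 s5 s6 s9 tbl') [::]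
    (o ++ flat_arcs (step_arcs created tbl v ops)).
Proof.
elim: ops created tbl v r5 r6 r9 o => [|op ops IH] created tbl v r5 r6 r9 o.
  by move=> _; exists (10 + size tbl), r5, r6, r9, tbl; rewrite muln0 /= addn0 cats0.
have sE : size (op :: ops) = (size ops).+1 by [].
rewrite sE mulnS doubleS -addSnnS -addSnnS addnC iterD.
case: op {sE} => A B //; rewrite [positive _]/= => pos.
- rewrite [encode_ops _ _]/= run_merge // -(size_rcons tbl v).
  rewrite -[step_arcs _ _ _ (_ :: _)]/(merge_arcs _ _ _ ++ step_arcs _ _ _ _).
  by rewrite flat_arcs_cat catA; apply: IH.
- rewrite [encode_ops _ _]/= run_resolve.
  rewrite -[step_arcs _ _ _ (_ :: _)]/(resolve_arcs _ _ _ ++ step_arcs _ _ _ _).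
  by rewrite flat_arcs_cat catA; apply: IH.
Qed.

(** Numbers below [#|V|] are the vertices and the next [#|V|.*2] the node pairs of the singletons;
    nodes made by the steps come after these. *)
Definition model_arcs (V : finType) (ops : seq (cop V)) : seq (nat * nat * nat) :=
  base_arcs 0 #|V| #|V| ++
  step_arcs [seq [set x] | x <- enum V] (base_table #|V| #|V|)
    (#|V| + #|V|.*2) ops.

Definition model_order (V : finType) (ops : seq (cop V)) : nat :=
  #|V| + #|V|.*2 + (size ops).*2.

Lemma size_base_table v n : size (base_table v n) = n.
Proof. by elim: n v => //= n IH v; rewrite IH. Qed.

Lemma model_program_computes (V : finType) (ops : seq (cop V)) t :
  positive ops -> 8 + 14 * #|V| + 47 * size ops <= t ->
  computes_within model_program (encode_sequence ops) t
    (rcons (flat_arcs (model_arcs ops)) (model_order ops)).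
Proof.
move=> pos le_t.
(* The 8 consists of 5 initializing instructions, 1 that leaves the vertex loop, and 2 that leave
   the step loop and write the order. The surplus is spent in the halted configuration. *)
have -> : t = (t - (8 + 14 * #|V| + 47 * size ops)) +
              (2 + (47 * size ops + (1 + (14 * #|V| + 5)))) by lia.
rewrite /computes_within.
(* Ten explicit zeros, one per register, make the memory after initialization literally [memory]
   with an empty table. *)
have -> : ram_init (encode_sequence ops) =
          config_of (LConfig 0 (nseq 10 0) (encode_sequence ops) [::]).
  by congr Config; apply/funext => z; rewrite nth_nseq if_same.
rewrite iter_ram_step_config_of iterD [iter (2 + _) _ _]iterD
  [iter (_ * _ + (1 + _)) _ _]iterD [iter (1 + _) _ _]iterD [iter (_ * _ + 5) _ _]iterD.
set c := iter 2 _ _.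
suff : exists s, c = LConfig 84 s [::]
  (rcons (flat_arcs (model_arcs ops)) (model_order ops)).
  by case=> s ->; rewrite iter_lstep_halted.
rewrite {}/c.
have -> : run 5 (LConfig 0 (nseq 10 0) (encode_sequence ops) [::]) =
  LConfig 5 (memory #|V| (10 + size (Nil nat)) #|V| 0 (size ops) 0 0 0 [::])
    (encode_ops [seq [set x] | x <- enum V] ops) [::].
  by [].
rewrite run_vertices /= add0n.
set c := LConfig 5 _ _ _.
have -> : lstep model_program c = LConfig 19 (lmem c) (linp c) (loutp c) by [].
rewrite {}/c [lmem _]/= [linp _]/= [loutp _]/=.
rewrite -{1}(size_base_table #|V| #|V|).
have [k [s5 [s6 [s9 [tbl' ->]]]]] := run_steps [seq [set x] | x <- enum V]
  (base_table #|V| #|V|) (#|V| + #|V|.*2) #|V| 0 0 0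
  (flat_arcs (base_arcs 0 #|V| #|V|)) pos.
by rewrite /model_arcs flat_arcs_cat; eexists.
Qed.

(** * Weighted reachability in a list of arcs *)

Inductive reach (es : seq (nat * nat * nat)) : nat -> nat -> nat -> Prop :=
  | ReachNil u : reach es u u 0
  | ReachCons u v z w k :
      (u, v, w) \in es -> reach es v z k -> reach es u z (w + k).

Lemma reach_trans es u v z k l :
  reach es u v k -> reach es v z l -> reach es u z (k + l).
Proof.
elim=> // {u v k} [] u v z' w k uv _ IH /IH vz; rewrite -addnA.
exact: ReachCons uv vz.
Qed.

Lemma reach_arc es u v w : (u, v, w) \in es -> reach es u v w.
Proof. by move=> uv; rewrite -(addn0 w); apply: ReachCons uv (ReachNil _ _). Qed.

(** This monotonicity is the reason for working with plain numbers: walks survive every extension of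
    the arc list, with no node type that changes along with it. *)
Lemma sub_reach es es' u v k :
  {subset es <= es'} -> reach es u v k -> reach es' u v k.
Proof.
move=> sub; elim=> {u v k} [u|u v z w k uv _ vz]; first exact: ReachNil.
exact: ReachCons (sub _ uv) vz.
Qed.

(** Each new arc has an end that is fresh, that is at least [v], while all old arcs lie below [v].
    Weights are dropped, so no pair of nodes can receive two of them. *)
Lemma uniq_unzip1_cat (v : nat) (es fs : seq (nat * nat * nat)) :
  uniq (unzip1 es) -> uniq (unzip1 fs) ->
  (forall a, a \in es -> a.1.1 < v /\ a.1.2 < v) ->
  (forall a, a \in fs -> v <= a.1.1 \/ v <= a.1.2) ->
  uniq (unzip1 (es ++ fs)).
Proof.
move=> ues ufs es_lt fs_ge; rewrite /unzip1 map_cat cat_uniq ues ufs andbT /=.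
apply/hasPn => p /mapP[a /fs_ge a_ge ->]; apply/mapP => -[b /es_lt b_lt ab].
case: b_lt; rewrite -ab !ltnNge => /negP b1 /negP b2; by case: a_ge.
Qed.

(** * Arcs and table of the singletons *)

Lemma nth_base_table v n i : i < n -> nth 0 (base_table v n) i = v + i.*2.
Proof.
elim: n v i => // n IH v [|i] /= ilt; first by rewrite addn0.
by rewrite IH //; lia.
Qed.

Lemma mem_base_table v n a : a \in base_table v n ->
  v <= a /\ a.+1 < v + n.*2.
Proof.
elim: n v => //= n IH v; rewrite inE => /predU1P[->|/IH]; lia.
Qed.

Lemma base_table_uniq v n : uniq (base_table v n).
Proof.
elim: n v => //= n IH v; rewrite IH andbT.
by apply/negP => /mem_base_table; lia.
Qed.

Lemma mem_base_arcs x v n e :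
  (e \in base_arcs x v n) <->
  exists2 i, i < n & e \in vertex_arcs (x + i) (v + i.*2).
Proof.
elim: n x v => [|n IH] x v; first by split=> // -[].
rewrite -[base_arcs _ _ _.+1]/(vertex_arcs x v ++ base_arcs x.+1 v.+2 n) mem_cat.
split=> [/orP[xe|/IH[i ilt ie]]|[[|i] ilt ie]].
- by exists 0; rewrite // !addn0.
- exists i.+1; rewrite // doubleS.
  by rewrite (_ : x + _ = x.+1 + i) 1?(_ : v + _ = v.+2 + i.*2) //; lia.
- by rewrite !addn0 in ie; rewrite ie.
- apply/orP; right; apply/IH; exists i => //; move: ie; rewrite doubleS.
  by rewrite (_ : x + _ = x.+1 + i) 1?(_ : v + _ = v.+2 + i.*2) //; lia.
Qed.

Lemma base_arcs_uniq x v n : x + n <= v -> uniq (unzip1 (base_arcs x v n)).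
Proof.
elim: n x v => // n IH x v le_v.
rewrite -[base_arcs _ _ _.+1]/(vertex_arcs x v ++ base_arcs x.+1 v.+2 n).
rewrite /unzip1 map_cat cat_uniq IH; last lia.
rewrite andbT; apply/andP; split; first by rewrite /= !inE !xpair_eqE; lia.
apply/hasPn => p /mapP[e /mem_base_arcs[i ilt]]; rewrite !inE => ie ->.
by case/orP: ie => /eqP -> /=; rewrite !xpair_eqE; lia.
Qed.

(** * The invariant and its preservation by merges and resolves *)

Section Model.
Variables (V : finType) (G : graph V).
Implicit Types (created : seq {set V}) (tbl : seq nat)
  (es : seq (nat * nat * nat)) (x y : V) (k : nat) (l : bool * {set V}).

(** A bound instead of an exact length: a resolve of overlapping parts admits a walk of weight 1
    from a vertex back to itself. *)
Definition within x k y : Prop :=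
  exists p, [/\ path (adj G) x p, last x p = y & size p <= k].

Lemma within_leq x k k' y : k <= k' -> within x k y -> within x k' y.
Proof. by move=> kk' [p [xp py pk]]; exists p; split=> //; apply: leq_trans kk'. Qed.

Lemma within_adj x k y z : within x k y -> adj G y z -> within x k.+1 z.
Proof.
case=> p [xp py pk] yz; exists (rcons p z).
by rewrite rcons_path xp py last_rcons size_rcons.
Qed.

(* The meaning of standing at a node labelled (b, A) after weight k on a walk
   from x: distance at most k from x to some vertex of A if b holds, to every
   vertex of A otherwise. *)
Definition holds x k l : Prop :=
  if l.1 then exists2 y, y \in l.2 & within x k y
  else forall y, y \in l.2 -> within x k y.

Definition sound_arc (L : nat -> bool * {set V}) (a : nat * nat * nat) : Prop :=
  forall x k, holds x k (L a.1.1) -> holds x (k + a.2) (L a.1.2).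

Record labelling created tbl es (L : nat -> bool * {set V}) : Prop := Labelling {
  label_vertex x : L (enum_rank x) = (false, [set x]);
  label_upper i : i < size created ->
    L (nth 0 tbl i) = (true, nth set0 created i);
  label_lower i : i < size created ->
    L (nth 0 tbl i).+1 = (false, nth set0 created i);
  label_sound a : a \in es -> sound_arc L a
}.

(** The invariant kept after each step. [model_up] and [model_down] provide short walks and so bound
    distances in the model from above; [model_label] bounds them from below. The other fields keep
    new nodes fresh and arcs distinct. *)
Record model created tbl (v : nat) es : Prop := Model {
  model_size : size tbl = size created;
  model_uniq_tbl : uniq tbl;
  model_tbl a : a \in tbl -> a.+1 < v;
  model_card : #|V| <= v;
  model_lt a : a \in es -> a.1.1 < v /\ a.1.2 < v;
  model_weight a : a \in es -> a.2 <= 1;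
  model_uniq : uniq (unzip1 es);
  model_up i x : i < size created -> x \in nth set0 created i ->
    reach es (enum_rank x) (nth 0 tbl i) 0;
  model_down i x : i < size created -> x \in nth set0 created i ->
    reach es (nth 0 tbl i).+1 (enum_rank x) 0;
  model_label : exists L, labelling created tbl es L
}.

Definition extend (L : nat -> bool * {set V}) (v : nat) l l' (u : nat) :=
  if u < v then L u else if u == v then l else l'.

Lemma extend_lt L v l l' u : u < v -> extend L v l l' u = L u.
Proof. by rewrite /extend => ->. Qed.

Lemma extend0 L v l l' : extend L v l l' v = l.
Proof. by rewrite /extend ltnn eqxx. Qed.

Lemma extend1 L v l l' : extend L v l l' v.+1 = l'.
Proof. by rewrite /extend ltnNge leqnSn /= eqn_leq ltnn. Qed.

Lemma mem_upper_node created tbl A :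
  size tbl = size created -> A \in created -> upper_node created tbl A \in tbl.
Proof. by move=> sz Ac; rewrite mem_nth // sz index_mem. Qed.

(** Old arcs only touch nodes below [v], whose labels are unchanged, so only the new arcs need
    checking. *)
Lemma labelling_extend created tbl v es fs L l l' :
  model created tbl v es -> labelling created tbl es L ->
  (forall a, a \in fs -> sound_arc (extend L v l l') a) ->
  labelling created tbl (es ++ fs) (extend L v l l').
Proof.
move=> M [Lv Lu Ll Ls] fs_sound.
have nth_lt i : i < size created -> (nth 0 tbl i).+1 < v.
  by move=> ic; apply: (model_tbl M); rewrite mem_nth // (model_size M).
split=> [x|i ic|i ic|a].
- rewrite extend_lt ?Lv //; apply: leq_trans (model_card M); exact: ltn_ord.
- by rewrite extend_lt ?Lu // ltnW // nth_lt.
- by rewrite extend_lt ?Ll // nth_lt.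
rewrite mem_cat => /orP[aes|]; last exact: fs_sound.
have [lt1 lt2] := model_lt M aes.
by rewrite /sound_arc !extend_lt //; apply: Ls.
Qed.

Lemma model_merge created tbl v es A B :
  model created tbl v es -> A \in created -> B \in created -> A != B ->
  model (rcons created (A :|: B)) (rcons tbl v) v.+2
    (es ++ merge_arcs (upper_node created tbl A) (upper_node created tbl B) v).
Proof.
move=> M Ac Bc AB; have szE := model_size M.
have := mem_upper_node szE Ac; have := mem_upper_node szE Bc.
set a := upper_node _ _ A; set b := upper_node _ _ B => btbl atbl.
have a_lt := model_tbl M atbl; have b_lt := model_tbl M btbl.
(* With equal nodes the merge would list the same arc twice; distinctness comes from that of the
   parts and of the table entries. *)
have ab : a != b.
  rewrite /a /b /upper_node nth_uniq ?(model_uniq_tbl M) ?szE ?index_mem //.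
  apply: contra AB => /eqP AB.
  by rewrite -(nth_index set0 Ac) AB nth_index.
have sub : {subset es <= es ++ merge_arcs a b v}.
  by move=> e ees; rewrite mem_cat ees.
have fsP e : e \in merge_arcs a b v -> e \in es ++ merge_arcs a b v.
  by move=> ees; rewrite mem_cat ees orbT.
have idxA : index A created < size created by rewrite index_mem.
have idxB : index B created < size created by rewrite index_mem.
split.
- by rewrite !size_rcons szE.
- rewrite rcons_uniq (model_uniq_tbl M) andbT.
  by apply/negP => /(model_tbl M); rewrite ltnNge leqnSn.
- by move=> e; rewrite mem_rcons inE => /predU1P[-> //|/(model_tbl M)]; lia.
- by have := model_card M; lia.
- move=> e; rewrite mem_cat => /orP[/(model_lt M)|]; first lia.
  by rewrite !inE => /or4P[] /eqP -> /=; lia.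
- move=> e; rewrite mem_cat => /orP[/(model_weight M)//|].
  by rewrite !inE => /or4P[] /eqP ->.
- apply: (@uniq_unzip1_cat v); [exact: model_uniq M| |exact: (model_lt M)|].
  + rewrite /= !inE !xpair_eqE; lia.
  + by move=> e; rewrite !inE => /or4P[] /eqP -> /=; lia.
- move=> i x; rewrite size_rcons ltnS leq_eqVlt => /predU1P[->|ic].
    rewrite -{2}szE !nth_rcons !ltnn !eqxx inE => /orP[] xAB.
    + apply: (@reach_trans _ _ a _ 0 0); last by apply/reach_arc/fsP; rewrite !inE eqxx.
      by apply: sub_reach sub _; apply: model_up M _ _ idxA _; rewrite nth_index.
    + apply: (@reach_trans _ _ b _ 0 0); last first.
        by apply/reach_arc/fsP; rewrite !inE eqxx ?orbT.
      by apply: sub_reach sub _; apply: model_up M _ _ idxB _; rewrite nth_index.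
  rewrite !nth_rcons szE ic => xi.
  by apply: sub_reach sub _; apply: model_up M _ _ ic xi.
- move=> i x; rewrite size_rcons ltnS leq_eqVlt => /predU1P[->|ic].
    rewrite -{2}szE !nth_rcons !ltnn !eqxx inE => /orP[] xAB.
    + apply: (@reach_trans _ _ a.+1 _ 0 0).
        by apply/reach_arc/fsP; rewrite !inE eqxx ?orbT.
      by apply: sub_reach sub _; apply: model_down M _ _ idxA _; rewrite nth_index.
    + apply: (@reach_trans _ _ b.+1 _ 0 0).
        by apply/reach_arc/fsP; rewrite !inE eqxx ?orbT.
      by apply: sub_reach sub _; apply: model_down M _ _ idxB _; rewrite nth_index.
  rewrite !nth_rcons szE ic => xi.
  by apply: sub_reach sub _; apply: model_down M _ _ ic xi.
- have [L LL] := model_label M.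
  pose L' := extend L v (true, A :|: B) (false, A :|: B).
  have L'a : L' a = (true, A).
    by rewrite /L' extend_lt ?(label_upper LL) ?nth_index //; lia.
  have L'b : L' b = (true, B).
    by rewrite /L' extend_lt ?(label_upper LL) ?nth_index //; lia.
  have L'a1 : L' a.+1 = (false, A).
    by rewrite /L' extend_lt ?(label_lower LL) ?nth_index.
  have L'b1 : L' b.+1 = (false, B).
    by rewrite /L' extend_lt ?(label_lower LL) ?nth_index.
  have L'v : L' v = (true, A :|: B) by rewrite /L' extend0.
  have L'v1 : L' v.+1 = (false, A :|: B) by rewrite /L' extend1.
  have fs_sound e : e \in merge_arcs a b v -> sound_arc L' e.
    rewrite !inE => /or4P[] /eqP -> x k /=;
      rewrite ?(L'a, L'b, L'a1, L'b1, L'v, L'v1) addn0 /holds /=.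
    + by case=> y yA xy; exists y; rewrite // inE yA.
    + by case=> y yA xy; exists y; rewrite // inE yA orbT.
    + by move=> xA y yA; apply: xA; rewrite inE yA.
    + by move=> xA y yA; apply: xA; rewrite inE yA orbT.
  have [Lv Lu Ll Ls] := labelling_extend M LL fs_sound.
  exists L'; split=> // i; rewrite size_rcons ltnS leq_eqVlt => /predU1P[->|ic].
  + by rewrite -{1}szE !nth_rcons !ltnn !eqxx.
  + by rewrite !nth_rcons szE ic; apply: Lu.
  + by rewrite -{1}szE !nth_rcons !ltnn !eqxx.
  + by rewrite !nth_rcons szE ic; apply: Ll.
Qed.

(** Going up to [a], through [v] and down from [b.+1] costs 1 in total. This is sound because all
    pairs between [A] and [B] are edges: near some vertex of [A] at weight k means near every vertex
    of [B] at weight k + 1. *)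
Lemma model_resolve created tbl v es A B :
  model created tbl v es -> A \in created -> B \in created ->
  between A B \subset edges G ->
  let es' :=
    es ++ resolve_arcs (upper_node created tbl A) (upper_node created tbl B) v in
  model created tbl v.+2 es' /\
  forall x y, x \in A -> y \in B ->
    reach es' (enum_rank x) (enum_rank y) 1 /\
    reach es' (enum_rank y) (enum_rank x) 1.
Proof.
move=> M Ac Bc AB; have szE := model_size M.
have := mem_upper_node szE Ac; have := mem_upper_node szE Bc.
set a := upper_node _ _ A; set b := upper_node _ _ B => btbl atbl es'.
have a_lt := model_tbl M atbl; have b_lt := model_tbl M btbl.
have sub : {subset es <= es'} by move=> e ees; rewrite mem_cat ees.
have fsP e : e \in resolve_arcs a b v -> e \in es'.
  by move=> ees; rewrite mem_cat ees orbT.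
have idxA : index A created < size created by rewrite index_mem.
have idxB : index B created < size created by rewrite index_mem.
have adjAB x y : x \in A -> y \in B -> x != y -> adj G x y.
  move=> xA yB xy; apply: (subsetP AB); apply/imset2P.
  by exists x y; rewrite // inE yB.
split; last first.
  move=> x y xA yB; split.
  - apply: (@reach_trans _ _ a _ 0 1).
      by apply: sub_reach sub _; apply: model_up M _ _ idxA _; rewrite nth_index.
    apply: (@reach_trans _ _ v _ 1 0); first by apply/reach_arc/fsP; rewrite !inE eqxx.
    apply: (@reach_trans _ _ b.+1 _ 0 0).
      by apply/reach_arc/fsP; rewrite !inE eqxx ?orbT.
    by apply: sub_reach sub _; apply: model_down M _ _ idxB _; rewrite nth_index.
  - apply: (@reach_trans _ _ b _ 0 1).
      by apply: sub_reach sub _; apply: model_up M _ _ idxB _; rewrite nth_index.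
    apply: (@reach_trans _ _ v.+1 _ 1 0).
      by apply/reach_arc/fsP; rewrite !inE eqxx ?orbT.
    apply: (@reach_trans _ _ a.+1 _ 0 0).
      by apply/reach_arc/fsP; rewrite !inE eqxx ?orbT.
    by apply: sub_reach sub _; apply: model_down M _ _ idxA _; rewrite nth_index.
split.
- by [].
- exact: model_uniq_tbl M.
- by move=> e /(model_tbl M); lia.
- by have := model_card M; lia.
- move=> e; rewrite mem_cat => /orP[/(model_lt M)|]; first lia.
  by rewrite !inE => /or4P[] /eqP -> /=; lia.
- move=> e; rewrite mem_cat => /orP[/(model_weight M)//|].
  by rewrite !inE => /or4P[] /eqP ->.
- apply: (@uniq_unzip1_cat v); [exact: model_uniq M| |exact: (model_lt M)|].
  + rewrite /= !inE !xpair_eqE; lia.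
  + by move=> e; rewrite !inE => /or4P[] /eqP -> /=; lia.
- by move=> i x ic xi; apply: sub_reach sub _; apply: model_up M _ _ ic xi.
- by move=> i x ic xi; apply: sub_reach sub _; apply: model_down M _ _ ic xi.
- have [L LL] := model_label M.
  (* At an intermediate node the weight 1 is already paid, so it carries the label of the lower node
     it leads to. *)
  pose L' := extend L v (false, B) (false, A).
  have L'a : L' a = (true, A).
    by rewrite /L' extend_lt ?(label_upper LL) ?nth_index //; lia.
  have L'b : L' b = (true, B).
    by rewrite /L' extend_lt ?(label_upper LL) ?nth_index //; lia.
  have L'a1 : L' a.+1 = (false, A).
    by rewrite /L' extend_lt ?(label_lower LL) ?nth_index.
  have L'b1 : L' b.+1 = (false, B).
    by rewrite /L' extend_lt ?(label_lower LL) ?nth_index.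
  have L'v : L' v = (false, B) by rewrite /L' extend0.
  have L'v1 : L' v.+1 = (false, A) by rewrite /L' extend1.
  suff fs_sound e : e \in resolve_arcs a b v -> sound_arc L' e.
    by exists L'; apply: labelling_extend M LL _.
  rewrite !inE => /or4P[] /eqP -> x k /=;
    rewrite ?(L'a, L'b, L'a1, L'b1, L'v, L'v1) ?addn0 ?addn1 /holds //=.
  + case=> y yA xy z zB; have [<-|yz] := eqVneq y z; first exact: within_leq xy.
    exact: within_adj xy (adjAB _ _ yA zB yz).
  + case=> y yB xy z zA; have [<-|yz] := eqVneq y z; first exact: within_leq xy.
    apply: within_adj xy _; rewrite /adj setUC.
    by apply: adjAB; rewrite // eq_sym.
Qed.

Let singletons := [seq [set x] | x <- enum V].

Lemma nth_singletons x : nth set0 singletons (enum_rank x) = [set x].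
Proof.
by rewrite (nth_map x) ?nth_enum_rank // -cardE ltn_ord.
Qed.

Lemma singletons_rank i :
  i < size singletons -> exists x, i = enum_rank x :> nat.
Proof.
rewrite size_map -cardE => ilt; exists (enum_val (Ordinal ilt)).
by rewrite enum_valK.
Qed.

Lemma model_base :
  model singletons (base_table #|V| #|V|) (#|V| + #|V|.*2)
    (base_arcs 0 #|V| #|V|).
Proof.
have sz : size singletons = #|V| by rewrite size_map -cardE.
have rank_arcs x : {subset vertex_arcs (enum_rank x) (#|V| + (enum_rank x).*2)
    <= base_arcs 0 #|V| #|V|}.
  by move=> e ie; apply/mem_base_arcs; exists (enum_rank x : nat).
split.
- by rewrite size_base_table sz.
- exact: base_table_uniq.
- by move=> a /mem_base_table[].
- by rewrite leq_addr.
- move=> e /mem_base_arcs; move: #|V| => n [i ilt].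
  by rewrite !inE => /orP[] /eqP -> /=; lia.
- by move=> e /mem_base_arcs[i ilt]; rewrite !inE => /orP[] /eqP ->.
- exact: base_arcs_uniq.
- move=> i x /singletons_rank[y ->]; rewrite nth_singletons inE => /eqP ->.
  by rewrite nth_base_table //; apply/reach_arc/(rank_arcs y); rewrite !inE eqxx.
- move=> i x /singletons_rank[y ->]; rewrite nth_singletons inE => /eqP ->.
  by rewrite nth_base_table //; apply/reach_arc/(rank_arcs y); rewrite !inE eqxx orbT.
(* Past the vertices, the parity of the offset tells upper from lower and its half is the index of
   the singleton. *)
pose L u := if u < #|V| then (false, nth set0 singletons u)
            else (~~ odd (u - #|V|), nth set0 singletons (u - #|V|)./2).
have Lv x : L (enum_rank x) = (false, [set x]).
  by rewrite /L ltn_ord nth_singletons.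
have Lu i : L (#|V| + i.*2) = (true, nth set0 singletons i).
  by rewrite /L ltnNge leq_addr addKn odd_double doubleK.
have Ll i : L (#|V| + i.*2).+1 = (false, nth set0 singletons i).
  rewrite /L ltnNge -addnS leq_addr addKn oddS odd_double /=.
  by rewrite uphalf_double.
exists L; split=> // [i|i|e /mem_base_arcs[i ilt]].
- by rewrite sz => ilt; rewrite nth_base_table.
- by rewrite sz => ilt; rewrite nth_base_table.
rewrite -sz in ilt; have [x ->] := singletons_rank ilt.
rewrite !inE => /orP[] /eqP -> y k /=; rewrite Lv ?Lu ?Ll nth_singletons addn0 //.
by rewrite /holds /= => /(_ x); rewrite inE eqxx => /(_ isT) xy; exists x; rewrite ?inE.
Qed.

End Model.

(** * Following a positive construction sequence *)

Section Steps.
Variable V : finType.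
Implicit Types (s : cstate V) (ops : seq (cop V)).

Fixpoint steps s ops s' : Prop :=
  if ops is o :: ops' then exists2 t, cstep o s t & steps t ops' s' else s = s'.

Lemma construction_steps (G : graph V) sts ops :
  construction_sequence G sts ops ->
  exists2 s, steps (init_cstate V) ops s & Eset s = edges G.
Proof.
case=> sz sts0 ok lastE; exists (last (init_cstate V) sts) => //.
rewrite -{1}sts0 {sts0 lastE}.
elim: ops sts sz ok => [|o ops IH] [|s [|t sts]] //= [sz] ok.
exists t; first exact: (ok 0 o).
by apply: (IH (t :: sts)) => [|i]; [rewrite /= sz|exact: (ok i.+1)].
Qed.

Lemma steps_Eset s ops s' : steps s ops s' -> Eset s \subset Eset s'.
Proof.
elim: ops s => [|o ops IH] s /= => [->//|[t st /IH]].
by apply: subset_trans; case: o st => A B [] *; subst t => //=; apply: subsetUl.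
Qed.

Definition operands ops : seq {set V} :=
  flatten [seq match o with
               | Merge A B | PosResolve A B | NegResolve A B => [:: A; B]
               end | o <- ops].

Lemma size_operands ops : size (operands ops) = (size ops).*2.
Proof. by elim: ops => //= -[] A B ops; rewrite /operands /= => ->. Qed.

(** A vertex x stays in its singleton part until [[set x]] is merged, so the first step that touches
    x has [[set x]] as an operand. [M] collects the operands of earlier steps for the induction. *)
Lemma steps_operands s ops s' (M : seq {set V}) :
  steps s ops s' ->
  (forall A x, A \in parts s -> x \in A -> A = [set x] \/ [set x] \in M) ->
  (forall e x, e \in Eset s -> x \in e -> [set x] \in M) ->
  forall e x, e \in Eset s' -> x \in e -> [set x] \in M ++ operands ops.
Proof.
elim: ops s M => [|o ops IH] s M; first by move=> /= ->; rewrite cats0.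
case=> t st ts parts_M E_M.
pose AB := operands [:: o].
have -> : M ++ operands (o :: ops) = (M ++ AB) ++ operands ops.
  by rewrite -catA -flatten_cat -map_cat.
have partsM A x : A \in parts s -> x \in A -> A = [set x] \/ [set x] \in M ++ AB.
  by move=> As /(parts_M A x As)[|xM]; [left|right; rewrite mem_cat xM].
apply: IH ts _ _.
  case: o @AB st partsM => A B AB []; try by move=> _ _ ->.
  move=> As Bs _ -> partsM C x /=.
  have AM : A \in AB by rewrite !inE eqxx.
  have BM : B \in AB by rewrite !inE eqxx orbT.
  rewrite !inE => /predU1P[->|/and3P[_ _ Cs]]; last exact: partsM.
  rewrite inE => /orP[/(partsM _ _ As)|/(partsM _ _ Bs)] [E|xM]; right=> //.
  - by rewrite mem_cat -E AM orbT.
  - by rewrite mem_cat -E BM orbT.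
case: o @AB st partsM => A B AB [].
- by move=> _ _ _ -> _ e x /= eE xe; rewrite mem_cat (E_M _ _ eE xe).
- move=> As Bs -> partsM e x /=.
  have AM : A \in AB by rewrite !inE eqxx.
  have BM : B \in AB by rewrite !inE eqxx orbT.
  rewrite !inE => /orP[eE xe|]; first by rewrite mem_cat (E_M _ _ eE xe).
  case/andP=> _ /imset2P[y z yA]; rewrite inE => /andP[zB _] ->.
  rewrite !inE => /orP[] /eqP ->.
  + by have [E|//] := partsM _ _ As yA; rewrite mem_cat -E AM orbT.
  + by have [E|//] := partsM _ _ Bs zB; rewrite mem_cat -E BM orbT.
- by move=> _ _ -> _ e x /= eE xe; rewrite mem_cat (E_M _ _ eE xe).
Qed.

Lemma card_vertices (G : graph V) ops s :
  steps (init_cstate V) ops s -> Eset s = edges G ->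
  #|V| <= (size ops).*2 + #|isolated G|.
Proof.
move=> st EG; rewrite -size_operands -(cardsC (isolated G)) addnC leq_add2r.
rewrite -(card_imset _ (@set1_inj V)).
apply: leq_trans (card_size (operands ops)).
apply/subset_leq_card/subsetP => A /imsetP[x xi ->{A}].
move: xi; rewrite !inE negb_forall => /existsP[y]; rewrite negbK => xy.
apply: (@steps_operands _ _ _ [::] st) (_ : [set x; y] \in _) _.
- move=> A z /imsetP[w _ ->]; rewrite inE => /eqP ->; by left.
- by move=> e z; rewrite inE.
- by rewrite EG.
- by rewrite !inE eqxx.
Qed.

(** As [Nset] stays empty, a resolve adds all of [between A B]; as [Eset] only grows up to the edges
    of [G], these pairs are edges, which is what [model_resolve] requires. *)
Lemma model_steps (G : graph V) ops s s' created tbl v es :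
  positive ops -> steps s ops s' -> Eset s' = edges G -> Nset s = set0 ->
  {subset parts s <= created} -> model G created tbl v es ->
  (forall x y, x != y -> [set x; y] \in Eset s ->
     reach es (enum_rank x) (enum_rank y) 1) ->
  let es' := es ++ step_arcs created tbl v ops in
  (exists created' tbl', model G created' tbl' (v + (size ops).*2) es') /\
  (forall x y, x != y -> [set x; y] \in edges G ->
     reach es' (enum_rank x) (enum_rank y) 1).
Proof.
elim: ops s created tbl v es => [|o ops IH] s created tbl v es.
  move=> _ /= -> <- _ _ M E_es; rewrite cats0 addn0.
  by split=> //; exists created, tbl.
case: o => A B //; rewrite [positive _]/= => pos.
- case=> t [As Bs AB tE] ts EG N0 sub M E_es.
  rewrite [step_arcs _ _ _ _]/= -[_ :: _]/(merge_arcs _ _ _ ++ step_arcs _ _ _ _).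
  rewrite catA [size _]/= doubleS -addSnnS -addSnnS.
  apply: (IH t) => //; rewrite ?tE //=.
  + move=> C; rewrite !inE mem_rcons inE => /predU1P[->|/and3P[_ _ /sub ->]].
      by rewrite eqxx.
    by rewrite orbT.
  + by apply: model_merge => //; apply: sub.
  + move=> x y xy xyE; apply: sub_reach (E_es x y xy xyE).
    by move=> e ees; rewrite mem_cat ees.
- case=> t [As Bs tE] ts EG N0 sub M E_es.
  have tG : Eset t \subset edges G by rewrite -EG (steps_Eset ts).
  have ABt : between A B \subset Eset t by rewrite tE /= N0 setD0 subsetUr.
  have [M' AB_es] := model_resolve M (sub _ As) (sub _ Bs) (subset_trans ABt tG).
  rewrite [step_arcs _ _ _ _]/= -[_ :: _]/(resolve_arcs _ _ _ ++ step_arcs _ _ _ _).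
  rewrite catA [size _]/= doubleS -addSnnS -addSnnS.
  apply: (IH t) => //; rewrite ?tE //= N0 setD0 => x y xy.
  rewrite inE => /orP[xyE|/imset2P[x' y' xA]].
    apply: sub_reach (E_es x y xy xyE).
    by move=> e ees; rewrite mem_cat ees.
  rewrite inE => /andP[yB xy'] E.
  have : x \in [set x'; y'] by rewrite -E !inE eqxx.
  have : y \in [set x'; y'] by rewrite -E !inE eqxx orbT.
  have [reach_xy reach_yx] := AB_es x' y' xA yB.
  (* Equal unordered pairs leave two orientations, which is why a resolve was shown to give walks in
     both directions. *)
  rewrite !inE => /orP[] /eqP yE /orP[] /eqP xE; subst x y => //.
  all: by rewrite eqxx in xy.
Qed.

End Steps.

(** * Sizes and minima *)

Lemma size_base_arcs x v n : size (base_arcs x v n) = n.*2.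
Proof. by elim: n x v => //= n IH x v; rewrite IH. Qed.

Lemma size_step_arcs (V : finType) (ops : seq (cop V)) created tbl v :
  size (step_arcs created tbl v ops) <= 4 * size ops.
Proof.
by elim: ops created tbl v => // -[] A B ops IH created tbl v //=;
  rewrite mulnS !ltnS IH.
Qed.

(** Minima only need mutual domination. The weaker form matters because a walk of weight k in the
    model yields a path of length at most k. *)
Lemma least_length_eq (L L' : nat -> Prop) :
  (forall k, L k -> exists2 k', k' <= k & L' k') ->
  (forall k, L' k -> exists2 k', k' <= k & L k') ->
  least_length L = least_length L'.
Proof.
move=> LL' L'L; rewrite /least_length.
case: pselect => [ex|nex]; case: pselect => [ex'|nex'] //.
- congr Some; case: ex_minnP => k /asboolP Lk mink.
  case: ex_minnP => k' /asboolP Lk' mink'.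
  have [i ik /asboolP /mink' k'i] := LL' k Lk.
  have [j jk /asboolP /mink kj] := L'L k' Lk'.
  by apply/eqP; rewrite eqn_leq (leq_trans kj) // (leq_trans k'i).
- case: nex'; case: ex => k /asboolP /LL'[k' _ L'k'].
  by exists k'; apply/asboolP.
- case: nex; case: ex' => k /asboolP /L'L[k' _ L'k'].
  by exists k'; apply/asboolP.
Qed.

(** * The weighted digraph of an arc list *)

Section Digraph.
Variables (h : nat) (es : seq (nat * nat * nat)).
Hypothesis es_lt : forall a, a \in es -> a.1.1 < h /\ a.1.2 < h.
Hypothesis es_weight : forall a, a \in es -> a.2 <= 1.
Hypothesis es_uniq : uniq (unzip1 es).

(** The weight is a boolean read as 0 or 1. Since listed weights are at most 1 and no pair is listed
    twice, it equals the listed weight. *)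
Definition digraph_of : wdigraph 'I_h :=
  WDigraph (fun u v : 'I_h => (u : nat, v : nat) \in unzip1 es)
    (fun u v : 'I_h => (u : nat, v : nat, 1) \in es).

Lemma unzip1_inj (T U : eqType) (s : seq (T * U)) p w w' :
  uniq (unzip1 s) -> (p, w) \in s -> (p, w') \in s -> w = w'.
Proof.
elim: s => //= -[q z] s IH /= /andP[qs us]; rewrite !inE !xpair_eqE.
case/orP=> [/andP[/eqP pq /eqP ->]|ps]; case/orP=> [/andP[/eqP pq' /eqP ->]|ps'] //.
- by case/negP: qs; rewrite -pq; apply/mapP; exists (p, w').
- by case/negP: qs; rewrite -pq'; apply/mapP; exists (p, w).
- exact: IH.
Qed.

Lemma arc_weight p w : (p, w) \in es -> ((p, 1) \in es) = w :> nat.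
Proof.
move=> pw; have := es_weight pw; case: w pw => [|[|//]] pw _; last by rewrite pw.
by case: (boolP (_ \in _)) => // p1; rewrite (unzip1_inj es_uniq pw p1).
Qed.

Lemma digraph_arc u v : Defs.arc digraph_of u v ->
  (u : nat, v : nat, weight digraph_of u v) \in es.
Proof. by case/mapP=> -[p w] pw /= ->; rewrite (arc_weight pw). Qed.

Lemma digraph_weights01 : weights01 digraph_of.
Proof. by move=> u v _ /=; case: ((_, _, 1) \in es). Qed.

Lemma unzip1_ordinals : exists ps : seq ('I_h * 'I_h),
  unzip1 es = [seq (val p.1, val p.2) | p <- ps].
Proof.
elim: es es_lt => [|[[u v] w] s IH] s_lt; first by exists [::].
have [|ps psE] := IH; first by move=> a sa; apply: s_lt; rewrite inE sa orbT.
have [uh vh] := s_lt (u, v, w) (mem_head _ _).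
by exists ((Ordinal uh, Ordinal vh) :: ps); rewrite /= psE.
Qed.

(** Lifting the arcs to ordinals in their original order shows that the numbers written by the
    program encode the digraph. *)
Lemma digraph_arcs : exists ps : seq ('I_h * 'I_h),
  [/\ uniq ps, forall u v, ((u, v) \in ps) = Defs.arc digraph_of u v,
      size ps = size es &
      flat_arcs es = flatten [seq [:: nat_of_ord a.1; nat_of_ord a.2;
                                      weight digraph_of a.1 a.2] | a <- ps]].
Proof.
have [ps psE] := unzip1_ordinals; exists ps; split.
- by move: es_uniq; rewrite psE => /map_uniq.
- move=> u v; rewrite /= psE.
  have inj : injective (fun p : 'I_h * 'I_h => (val p.1, val p.2)).
    by move=> [a b] [c d] /= [/val_inj -> /val_inj ->].
  by rewrite -(mem_map inj).
- by rewrite -(size_map fst es) -/(unzip1 es) psE size_map.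
- have {1}-> : es = [seq (p, nat_of_bool ((p, 1) \in es)) | p <- unzip1 es].
    rewrite -map_comp -[LHS]map_id; apply/eq_in_map => -[p w] pw /=.
    by rewrite (arc_weight pw).
  by rewrite psE /flat_arcs -!map_comp.
Qed.

Lemma digraph_wsize : wsize digraph_of = h + size es.
Proof.
have [ps [ups psE <- _]] := digraph_arcs; rewrite /wsize card_ord.
rewrite -(card_uniqP ups); congr addn; apply: eq_card => -[u v].
by rewrite inE psE.
Qed.

Lemma digraph_reach u z k (u0 z0 : 'I_h) :
  reach es u z k -> u0 = u :> nat -> z0 = z :> nat ->
  exists p, [/\ path (Defs.arc digraph_of) u0 p, last u0 p = z0 &
                walk_weight digraph_of u0 p = k].
Proof.
move=> uz; elim: uz u0 => {u z k} [u|u v z w k uv _ IH] u0 u0E z0E.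
  by exists [::]; split=> //; apply: val_inj; rewrite /= u0E.
have [_ vh] := es_lt uv; have [p [vp pz pk]] := IH (Ordinal vh) erefl z0E.
exists (Ordinal vh :: p); split=> //=.
- rewrite vp andbT u0E; apply/mapP; exists (u, v, w) => //.
- by rewrite pk u0E (arc_weight uv).
Qed.

End Digraph.

(** * Equality of distances *)

Section Distance.
Variables (V : finType) (G : graph V) (created : seq {set V}) (tbl : seq nat).
Variables (h : nat) (es : seq (nat * nat * nat)).
Hypothesis es_model : model G created tbl h es.
Hypothesis es_edges : forall x y, x != y -> [set x; y] \in edges G ->
  reach es (enum_rank x) (enum_rank y) 1.

Lemma walk_holds L x k (u : 'I_h) p :
  labelling G created tbl es L -> path (Defs.arc (digraph_of h es)) u p ->
  holds G x k (L u) ->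
  holds G x (k + walk_weight (digraph_of h es) u p) (L (last u p)).
Proof.
move=> LL; elim: p u k => [|v p IH] u k; first by rewrite addn0.
rewrite [path _ _ _]/= => /andP[uv vp] xu.
rewrite -[walk_weight _ _ _]/(weight _ u v + walk_weight _ v p) addnA.
apply: IH vp _.
apply: (label_sound LL (digraph_arc (model_weight es_model) (model_uniq es_model) uv)).
exact: xu.
Qed.

Lemma adj_neq x y : adj G x y -> x != y.
Proof.
move=> xy; have := subsetP (edges_pairs G) _ xy.
by rewrite inE cards2; case: (x != y).
Qed.

Lemma path_reach x p : path (adj G) x p ->
  reach es (enum_rank x) (enum_rank (last x p)) (size p).
Proof.
elim: p x => [|y p IH] x /=; first by move=> _; apply: ReachNil.
case/andP=> xy yp; rewrite -add1n; apply: reach_trans (IH y yp).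
exact: es_edges (adj_neq xy) xy.
Qed.

(** A walk from x to y starts under the label [(false, [set x])], true at weight 0, and ends under
    [(false, [set y])], so its weight bounds the distance in [G]. Conversely, each edge of a path is
    replaced by a walk of weight 1. *)
Lemma model_distance :
  distance_model G (digraph_of h es)
    (fun x => widen_ord (model_card es_model) (enum_rank x)).
Proof.
split=> [x y /(congr1 val) /= /val_inj /enum_rank_inj //|x y].
apply: least_length_eq => k [p [xp py pk]].
  have [L LL] := model_label es_model.
  have : holds G x 0 (L (enum_rank x)).
    rewrite (label_vertex LL) => z; rewrite inE => /eqP ->.
    by exists [::].
  move=> /(walk_holds LL xp); rewrite py pk (label_vertex LL) add0n.
  move=> /(_ y); rewrite inE eqxx => /(_ isT)[q [xq qy qk]].
  by exists (size q) => //; exists q.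
exists k => //; rewrite -pk.
by apply: digraph_reach (path_reach xp) _ _;
  rewrite ?py //; case: es_model.
Qed.

End Distance.

Theorem lemma7p1 :
  exists (p : program) (C : nat),
    forall (V : finType) (G : graph V) (sts : seq (cstate V)) (ops : seq (cop V)),
      construction_sequence G sts ops ->
      positive ops ->
      let m := size sts in
      exists (out : seq nat) (h : nat) (H : wdigraph 'I_h) (f : V -> 'I_h),
        [/\ computes_within p (encode_sequence ops) (C * (m + #|isolated G|)) out,
            encodes_wdigraph H out,
            (forall x, f x = enum_rank x :> nat),
            distance_model G H f &
            weights01 H /\ wsize H <= C * (m + #|isolated G|)].
Proof.
(* With s steps and i isolated vertices, [#|V|] is at most 2s + i. The time is then at most 75s +
   14i + 8 and the size at most 16s + 5i; 100 covers both. *)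
exists model_program, 100 => V G sts ops cs pos m.
have mE : m = (size ops).+1 by case: cs.
have [s st EG] := construction_steps cs.
have cardV := card_vertices st EG.
have sub : {subset parts (init_cstate V) <= [seq [set x] | x <- enum V]}.
  by move=> A /imsetP[x _ ->]; apply/map_f; rewrite mem_enum.
have E0 (x y : V) : x != y -> [set x; y] \in Eset (init_cstate V) ->
    reach (base_arcs 0 #|V| #|V|) (enum_rank x) (enum_rank y) 1.
  by rewrite inE.
have [[created [tbl M]] es_edges] :=
  model_steps pos st EG erefl sub (model_base G) E0.
have lt := model_lt M; have weight_le1 := model_weight M; have us := model_uniq M.
exists (rcons (flat_arcs (model_arcs ops)) (model_order ops)), (model_order ops).
exists (digraph_of (model_order ops) (model_arcs ops)).
exists (fun x => widen_ord (model_card M) (enum_rank x)); split=> //.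
- apply: model_program_computes => //.
  by move: cardV; rewrite mE; move: #|V| #|isolated G| (size ops) => a b c; lia.
- have [ps [ups psE _ ->]] := digraph_arcs lt weight_le1 us.
  by exists ps.
- exact: model_distance.
- split; first exact: digraph_weights01.
  rewrite (digraph_wsize lt weight_le1 us) /model_arcs /model_order.
  rewrite size_cat size_base_arcs mE.
  have := size_step_arcs ops [seq [set x] | x <- enum V] (base_table #|V| #|V|)
    (#|V| + #|V|.*2).
  move: (size (step_arcs _ _ _ _)) cardV => d.
  by move: #|V| #|isolated G| (size ops) => a b c; lia.
Qed.
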